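(* Let $G$ be a graph on the vertex set $\{x_1,\ldots,x_h\}$, let $n_1,\ldots,n_h$ be positive integers, and let $\mathcal{H}=\bigcup_{1\le i\le h}\{H_i^1,\ldots,H_i^{n_i}\}$, where each $H_i^j$ is a nonempty graph indexed by $x_i$. If $G\circ\mathcal{H}$ is a multi-clique corona graph, then $G\circ\mathcal{H}$ is vertex decomposable and hence sequentially Cohen--Macaulay.
   Context: All graphs are finite, simple and undirected. $\Bbbk$ is an arbitrary field. For a graph $G$, $I(G)=(xy : \{x,y\}\in E(G))\subset \Bbbk[V(G)]$ is the edge ideal. Multi-corona graph: $G\circ\mathcal{H}$ is the disjoint union of $G$ and all the graphs $H_i^j$ ($1\le i\le h$, $1\le j\le n_i$; pairwise disjoint vertex sets), with additional edges joining each $x_i$ to all vertices of $H_i^j$ for every $j=1,\ldots,n_i$. It is a multi-clique corona graph if every $H_i^j$ is a complete graph. The independence complex $\Delta(G)$ is the simplicial complex of independent sets of $G$. A simplicial complex $\Delta$ is vertex decomposable (in the not necessarily pure sense) if $\Delta$ is a simplex, or $\Delta=\emptyset$, or there is a vertex $x$ such that $\operatorname{link}_\Delta(\{x\})$ and $\operatorname{del}_\Delta(\{x\})=\{F\in\Delta: x\notin F\}$ are vertex decomposable and every facet of $\operatorname{del}_\Delta(\{x\})$ is a facet of $\Delta$. A graph is vertex decomposable if its independence complex is. A graded module $M$ over $S=\Bbbk[V(G)]$ is sequentially Cohen--Macaulay if there is a filtration $0=M_0\subset M_1\subset\cdots\subset M_t=M$ by graded submodules such that each $M_i/M_{i-1}$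 is Cohen--Macaulay and $\dim M_i/M_{i-1}<\dim M_{i+1}/M_i$ for all $i$. A graph $G$ is sequentially Cohen--Macaulay if $S/I(G)$ is. *)

(* Defs.v *)
From HB Require Import structures.
From mathcomp Require Import all_boot all_order all_algebra.
From mathcomp Require Import boolp classical_sets.
From mathcomp Require Import mpoly.

Set Implicit Arguments.
Unset Strict Implicit.
Unset Printing Implicit Defensive.

Import Order.TTheory GRing.Theory Num.Theory.
Local Open Scope ring_scope.

Record sgraph := SGraph {
  vert :> finType;
  adj : rel vert;
  adj_sym : ssrbool.symmetric adj;
  adj_irr : irreflexive adj }.

Definition complete_graph (G : sgraph) : Prop :=
  forall x y : G, x != y -> adj x y.

Section MultiCorona.
Variables (G : sgraph) (n : G -> nat) (H : forall i : G, 'I_(n i) -> sgraph).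

(* [inl x] is the vertex [x] of [G]; [inr] of the dependent triple (i, j, u)
   is the vertex [u] of [H i j]. *)
Definition mc_vert : finType :=
  (G + {p : {i : G & 'I_(n i)} & H (tagged p)})%type.

Definition mc_adj : rel mc_vert := fun u v =>
  match u, v with
  | inl x, inl y => adj x y
  | inl x, inr b => tag (tag b) == x
  | inr a, inl y => tag (tag a) == y
  | inr a, inr b => (tag a == tag b) && adj (tagged a) (tagged_as a b)
  end.

Lemma mc_adj_sym : ssrbool.symmetric mc_adj.
Proof.
move=> [x|[p x]] [y|[q y]] //=; first exact: adj_sym.
case: (eqVneq p q) => [E|] //=; subst q.
by rewrite !tagged_asE /= adj_sym.
Qed.

Lemma mc_adj_irr : irreflexive mc_adj.
Proof. by move=> [x|[p x]] /=; rewrite ?eqxx ?tagged_asE adj_irr. Qed.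

Definition multi_corona : sgraph := SGraph mc_adj_sym mc_adj_irr.

End MultiCorona.

Section Complexes.
Variable V : finType.
Implicit Types (D : {set {set V}}) (F : {set V}) (x : V).

Definition simplicial_complex D : Prop :=
  forall F F', F \in D -> F' \subset F -> F' \in D.

Definition facet D F : bool := maxset (fun F' => F' \in D) F.

Definition link D x : {set {set V}} :=
  [set F : {set V} | (x \notin F) && (x |: F \in D)].

Definition del D x : {set {set V}} := [set F in D | x \notin F].

(* A simplex is the complex of all subsets of some vertex set; for the empty
   vertex set this is the complex {∅}, as opposed to the void complex. *)
Inductive vertex_decomposable D : Prop :=
| VD_simplex F of D = powerset F
| VD_void of D = finset.set0
| VD_vertex x of finset.set1 x \in D
    & vertex_decomposable (link D x)
    & vertex_decomposable (del D x)
    & (forall F, facet (del D x) F -> facet D F).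

End Complexes.

Definition independence_complex (G : sgraph) : {set {set G}} :=
  [set F : {set G} | [forall x in F, forall y in F, ~~ adj x y]].

Lemma independence_complexP (G : sgraph) :
  simplicial_complex (independence_complex G).
Proof.
move=> F F'; rewrite !inE => /forall_inP HF /fintype.subsetP sub.
apply/forall_inP => x xF; apply/forall_inP => y yF.
by move/forall_inP: (HF x (sub x xF)) => /(_ y (sub y yF)).
Qed.

Definition vertex_decomposable_graph (G : sgraph) : Prop :=
  vertex_decomposable (independence_complex G).

(* A module is presented as a subquotient [P / Q] of an ambient module [A],
   where [Q `<=` P] are submodules of [A].  The submodules of [P / Q] are the
   [N / Q] with [Q `<=` N `<=` P], and [(N' / Q) / (N / Q) = N' / N] is again a
   subquotient of [A]. *)

Section Modules.
Local Open Scope classical_set_scope.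
Variable R : comNzRingType.

Definition submodule (A : lmodType R) (N : set A) : Prop :=
  N 0 /\ forall (a : R) (x y : A), N x -> N y -> N (a *: x + y).

Definition ideal (I : set R) : Prop := submodule (I : set R^o).

Definition prime_ideal (p : set R) : Prop :=
  [/\ ideal p, ~ p 1 & forall a b, p (a * b) -> p a \/ p b].

(* p 0 < p 1 < ... < p d are primes containing I, i.e. a chain of length d of
   primes of R / I. *)
Definition prime_chain (I : set R) (d : nat) (p : nat -> set R) : Prop :=
  (forall i, (i <= d)%N -> prime_ideal (p i) /\ I `<=` p i) /\
  (forall i, (i < d)%N -> p i `<` p i.+1).

Definition quotient_krull_dim (I : set R) (d : nat) : Prop :=
  (exists p, prime_chain I d p) /\
  (forall e p, prime_chain I e p -> (e <= d)%N).

Variable A : lmodType R.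
Implicit Types P Q : set A.

Definition annihilator P Q : set R :=
  [set a | forall x, P x -> Q (a *: x)].

(* dim (P / Q) = d, as the Krull dimension of R / Ann (P / Q);
   the zero module has no dimension in this sense. *)
Definition mod_dim P Q (d : nat) : Prop :=
  quotient_krull_dim (annihilator P Q) d.

Definition regular_elt P Q (f : R) : Prop :=
  forall x, P x -> Q (f *: x) -> Q x.

(* [s] is a regular sequence on [M = P / Q]: using
   [M / f M = P / (Q + f P)], each entry is a nonzerodivisor modulo the
   previous ones, and [M / s M] is nonzero. *)
Fixpoint regular_seq P Q (s : seq R) : Prop :=
  if s is f :: s' then
    regular_elt P Q f /\ regular_seq P [set q + f *: x | q in Q & x in P] s'
  else Q `<` P.

End Modules.

Section Graded.
Local Open Scope classical_set_scope.
Variables (k : fieldType) (n : nat).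
Local Notation S := {mpoly k[n]}.

Record gradedModule := GradedModule {
  gm_mod :> lmodType S;
  gm_deg : int -> set gm_mod;
  gm_deg0 : forall d, gm_deg d 0;
  gm_degB : forall d x y, gm_deg d x -> gm_deg d y -> gm_deg d (x - y);
  gm_degZ : forall (e : nat) d (f : S) x,
    f \is e.-homog -> gm_deg d x -> gm_deg (e%:Z + d) (f *: x);
  gm_span : forall x, exists (s : seq int) (y : int -> gm_mod),
    (forall d, gm_deg d (y d)) /\ x = \sum_(d <- s) y d;
  gm_indep : forall (s : seq int) (y : int -> gm_mod), uniq s ->
    (forall d, gm_deg d (y d)) -> \sum_(d <- s) y d = 0 ->
    forall d, d \in s -> y d = 0 }.

Definition poly_deg (d : int) : set S^o :=
  [set f : S | match d with Posz e => f \is e.-homog | Negz _ => f = 0 end].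

Lemma poly_deg0 d : poly_deg d 0.
Proof. by case: d => e //=; exact: dhomog0. Qed.

Lemma poly_degB d x y : poly_deg d x -> poly_deg d y -> poly_deg d (x - y).
Proof.
case: d => e /=; first exact: rpredB.
by move=> -> ->; rewrite subrr.
Qed.

Lemma poly_degZ (e : nat) d (f : S) (x : S^o) :
  f \is e.-homog -> poly_deg d x -> poly_deg (e%:Z + d) (f *: x).
Proof.
case: d => i hf; first by move=> hx; exact: dhomogM.
by rewrite /poly_deg /= => ->; rewrite scaler0; exact: poly_deg0.
Qed.

Lemma poly_span (x : S^o) : exists (s : seq int) (y : int -> S^o),
  (forall d, poly_deg d (y d)) /\ x = \sum_(d <- s) y d.
Proof.
exists [seq Posz e | e <- iota 0 (msize (x : S))].
exists (fun d => if d is Posz e then pihomog mdeg e x else 0); split.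
  by case=> e //=; exact: pihomogP.
have -> : iota 0 (msize (x : S)) = index_iota 0 (msize (x : S)).
  by rewrite /index_iota subn0.
by rewrite big_map big_mkord; exact: pihomog_partitionE.
Qed.

Lemma poly_indep (s : seq int) (y : int -> S^o) : uniq s ->
  (forall d, poly_deg d (y d)) -> \sum_(d <- s) y d = 0 ->
  forall d, d \in s -> y d = 0.
Proof.
move=> us hy s0 [e es|e _]; last by have := hy (Negz e).
have := congr1 (fun p : S => pihomog mdeg e p) s0.
rewrite [LHS](raddf_sum (pihomog mdeg e)) pihomog0 (big_rem _ es) /=.
rewrite (pihomog_dE (hy (Posz e))) big_seq big1 ?addr0 // => d.
rewrite mem_rem_uniq // inE => /andP[/= de _].
case: d de (hy d) => i /= de hi; last by rewrite hi pihomog0.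
by apply: (pihomog_ne0 _ hi); apply: contra de => /eqP->.
Qed.

Definition poly_gm : gradedModule :=
  @GradedModule S^o poly_deg poly_deg0 poly_degB poly_degZ poly_span poly_indep.

Definition irrelevant_ideal : set S := [set f | f@_0%MM = 0].

Section Subquotients.
Variable A : gradedModule.
Implicit Types P Q N : set A.

Definition graded_submodule N : Prop :=
  submodule N /\
  forall x, N x -> exists (s : seq int) (y : int -> A),
    (forall d, gm_deg d (y d) /\ N (y d)) /\ x = \sum_(d <- s) y d.

Definition irrelevant_regular P Q (s : seq S) : Prop :=
  (forall f, f \in s -> irrelevant_ideal f) /\ regular_seq P Q s.

(* The maximal length of a regular sequence of (not necessarily homogeneous)
   elements of the irrelevant maximal ideal. *)
Definition mod_depth P Q (d : nat) : Prop :=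
  (exists2 s, irrelevant_regular P Q s & size s = d) /\
  (forall s, irrelevant_regular P Q s -> (size s <= d)%N).

Definition cohen_macaulay P Q : Prop :=
  exists2 d, mod_dim P Q d & mod_depth P Q d.

Definition sequentially_CM P Q : Prop :=
  exists (t : nat) (M : nat -> set A),
    [/\ M 0%N = Q,
        M t = P,
        forall i, (i <= t)%N -> graded_submodule (M i),
        forall i, (i < t)%N -> M i `<` M i.+1 /\ cohen_macaulay (M i.+1) (M i)
      & forall i, (i.+1 < t)%N -> forall d e,
          mod_dim (M i.+1) (M i) d -> mod_dim (M i.+2) (M i.+1) e ->
          (d < e)%N].

End Subquotients.
End Graded.

Section EdgeIdeal.
Local Open Scope classical_set_scope.
Variables (k : fieldType) (G : sgraph).

(* The variable of k[V(G)] attached to the vertex x. *)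
Definition vvar (x : G) : {mpoly k[#|G|]} := 'X_(enum_rank x).

Definition edge_ideal : set {mpoly k[#|G|]} :=
  smallest (@ideal {mpoly k[#|G|]})
    [set f | exists x y : G, adj x y /\ f = vvar x * vvar y].

(* S / I(G) is the subquotient setT / I(G) of S. *)
Definition sequentially_CM_graph : Prop :=
  @sequentially_CM k #|G| (poly_gm k #|G|) setT edge_ideal.

End EdgeIdeal.

(* Main.v *)
(* The corona contains an independent set Z, one vertex from each clique, such
   that every vertex w outside Z has a neighbour z in Z with N[z] included in
   N[w].  Such a w is a shedding vertex (a facet avoiding w contains z or a
   neighbour of z), and the hypothesis passes to links and deletions.

   The same Z partitions the independent sets into the intervals [R, Phi R],
   with R avoiding Z and Phi R = R together with the vertices of Z not adjacent
   to R; |Phi R| does not increase with R.  Let J_d be spanned by the monomials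
   whose support is not a face A with |Phi (A \ Z)| >= d.  Then J_(d+1) / J_d is
   filtered by copies of the rings S / P_F with |F| = d.  The elementary
   symmetric polynomials e_d, ..., e_1 form a regular sequence on each of them:
   e_d is the product of the variables of F modulo P_F, and the boundary of the
   simplex on F is again partitioned into intervals with upper ends of size
   d - 1.  The bounds depth <= d and dim <= d both come from counting monomials
   in a regular sequence, or in elements chosen along a chain of primes. *)
Require Import Defs.
From mathcomp Require Import boolp classical_sets mpoly.
From mathcomp Require Import all_boot all_order all_algebra.

Set Implicit Arguments.
Unset Strict Implicit.
Unset Printing Implicit Defensive.

Import GRing.Theory.

(** * Shedding vertices and vertex decomposability *)

Section DominatedVertices.
Variable G : sgraph.
Implicit Types (U F : {set G}) (v w z : G).

Definition dominates w z : Prop :=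
  adj w z /\ forall v, adj v z -> v = w \/ adj v w.

(** The complex of the induced subgraph on [U], kept over the vertex type of [G]: links and
    deletions only shrink [U], which allows induction on its size. *)
Definition indep_in U : {set {set G}} :=
  [set F in independence_complex G | F \subset U].

Lemma independentP F :
  reflect (forall x y, x \in F -> y \in F -> ~~ adj x y)
          (F \in independence_complex G).
Proof.
rewrite inE; apply: (iffP forall_inP) => [h x y xF|h x xF].
  by move: (h x xF) => /forall_inP; apply.
by apply/forall_inP => y; apply: h.
Qed.

Lemma independentU1 x F : F \in independence_complex G ->
  (forall y, y \in F -> ~~ adj y x) -> x |: F \in independence_complex G.
Proof.
move=> /independentP iF hx; apply/independentP => a b.
rewrite !inE => /orP[/eqP->|aF] /orP[/eqP->|bF].
- by rewrite adj_irr.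
- by rewrite adj_sym hx.
- exact: hx.
- exact: iF.
Qed.

Lemma in_indep_in U F :
  (F \in indep_in U) = (F \in independence_complex G) && (F \subset U).
Proof. by rewrite [LHS]in_set. Qed.

Lemma link_indep_in U w : w \in U ->
  link (indep_in U) w = indep_in [set v in U | (v != w) && ~~ adj v w].
Proof.
move=> wU; apply/setP => F; rewrite [LHS]in_set !in_indep_in.
apply/andP/andP => [[wF /andP[iF sF]]|[iF /subsetP sF]].
  split; first by apply: independence_complexP iF (subsetUr _ _).
  apply/subsetP => v vF; rewrite !inE.
  rewrite (subsetP sF) ?inE ?vF ?orbT //=; apply/andP; split.
    by apply: contraNneq wF => <-.
  by move/independentP: iF; apply; rewrite !inE ?eqxx ?vF ?orbT.
split; first by apply/negP => /sF; rewrite !inE eqxx andbF.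
rewrite independentU1 //=.
  by apply/subsetP => v /setU1P[->//|/sF]; rewrite inE => /andP[].
by move=> y /sF; rewrite !inE => /and3P[].
Qed.

Lemma del_indep_in U w : del (indep_in U) w = indep_in (U :\ w).
Proof.
by apply/setP => F; rewrite [LHS]in_set !in_indep_in -andbA subsetD1.
Qed.

Lemma maxset_facet (D : {set {set G}}) F : simplicial_complex D ->
  F \in D -> (forall w, w \notin F -> w |: F \notin D) -> facet D F.
Proof.
move=> cD FD hF; apply/maxsetP; split=> // B BD FB.
apply/eqP; rewrite eqEsubset FB andbT; apply/subsetP => w wB.
apply/negPn/negP => wF; have /negP := hF w wF; apply.
by apply: cD BD _; apply/subsetP => v /setU1P[->//|/(subsetP FB)].
Qed.

Lemma indep_in_complex U : simplicial_complex (indep_in U).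
Proof.
move=> F F'; rewrite !in_indep_in => /andP[iF sF] F'F.
rewrite (independence_complexP iF F'F) /=.
exact: subset_trans sF.
Qed.

(** Any vertex of [U] outside [Z] is shed; when none is left, [U] is independent and the complex is
    a simplex. *)
Lemma vertex_decomposable_indep_in (Z U : {set G}) :
  Z \in independence_complex G ->
  (forall w, w \in U -> w \notin Z ->
     exists2 z, z \in Z :&: U & dominates w z) ->
  vertex_decomposable (indep_in U).
Proof.
move=> iZ; have [m] := ubnP #|U|; elim: m U => // m IH U ltU dom.
case: (pickP [pred w in U | w \notin Z]) => [w /andP[/= wU wZ]|sUZ]; last first.
  apply: (@VD_simplex _ _ U); apply/setP => F; rewrite in_indep_in powersetE.
  case: (boolP (F \subset U)) => [sF|]; last by rewrite andbF.
  rewrite (independence_complexP iZ) //; apply/subsetP => v /(subsetP sF) vU.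
  by have /= := sUZ v; rewrite vU => /negbFE.
have [z /setIP[zZ zU] [wz domz]] := dom w wU wZ.
have zw : z != w by apply: contraNneq wZ => <-.
apply: (@VD_vertex _ _ w).
- rewrite in_indep_in sub1set wU andbT; apply/independentP => x y.
  by rewrite !inE => /eqP-> /eqP->; rewrite adj_irr.
- rewrite link_indep_in //; apply: IH => [|v].
    apply: (@leq_trans #|U|) => [|]; last by rewrite -ltnS.
    apply: proper_card.
    apply/properP; split.
      by apply/subsetP => v; rewrite inE => /andP[].
    by exists w => //; rewrite inE eqxx andbF.
  rewrite inE => /and3P[vU vw avw] vZ.
  have [y /setIP[yZ yU] [vy domy]] := dom v vU vZ.
  exists y => //; rewrite !inE yZ yU /=; apply/andP; split.
    by apply: contraNneq wZ => <-.
  (* If [y] were adjacent to [w], then [w] would be [v] or a neighbour of [v], but the link keeps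
     only non-neighbours of [w]. *)
  apply/negP => ayw; have [] := domy w; first by rewrite adj_sym.
    by move=> /esym/eqP; rewrite (negbTE vw).
  by rewrite adj_sym (negbTE avw).
- rewrite del_indep_in; apply: IH => [|v].
    by apply: leq_trans (proper_card (properD1 wU)) _; rewrite -ltnS.
  rewrite !inE => /andP[vw vU] vZ.
  have [y /setIP[yZ yU] dvy] := dom v vU vZ.
  by exists y => //; rewrite !inE yZ yU andbT; apply: contraNneq wZ => <-.
- rewrite del_indep_in => F /maxsetP[]; rewrite in_indep_in => /andP[iF sF] maxF.
  have FU : F \subset U by rewrite (subset_trans sF) ?subD1set.
  have wF : w \notin F by apply/negP => /(subsetP sF); rewrite !inE eqxx.
  apply: maxset_facet; [exact: indep_in_complex|by rewrite in_set iF|].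
  move=> v vF; apply/negP; rewrite in_indep_in => /andP[ivF svF].
  have [vw|vw] := eqVneq v w; last first.
    suff : v |: F = F by move/setP/(_ v); rewrite setU11 (negbTE vF).
    apply: maxF; last exact: subsetUr.
    rewrite in_indep_in ivF subUset sF andbT sub1set !inE vw.
    by rewrite (subsetP svF) ?setU11.
  (* If [w] could be added to [F], no element of [F] would be [w] or adjacent to it, hence none
     adjacent to [z]; then [z] could be added, against maximality in the deletion. *)
  have adjF y : y \in F -> ~~ adj y w.
    by move=> yF; move/independentP: ivF; apply; rewrite ?inE ?yF ?vw ?eqxx ?orbT.
  have zF : z \notin F.
    by apply/negP => /adjF; rewrite adj_sym wz.
  suff : z |: F = F by move/setP/(_ z); rewrite setU11 (negbTE zF).
  apply: maxF; last exact: subsetUr.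
  rewrite in_indep_in independentU1 //=.
    by rewrite subUset sF andbT sub1set !inE zw zU.
  move=> y yF; apply/negP => /domz[yw|]; last by rewrite (negbTE (adjF y yF)).
  by rewrite -yw yF in wF.
Qed.

End DominatedVertices.

(** * Weakly regular sequences and flags of ideals *)

Section WeaklyRegular.
Local Open Scope ring_scope.
Variable R : comNzRingType.
Implicit Types (P Q N : set R^o) (f c : R) (s : seq R).

Definition add_multiples Q f P : set R^o :=
  ([set q + f *: x | q in Q & x in P])%classic.

Lemma add_multiplesP Q f P y :
  add_multiples Q f P y <-> exists q x, [/\ Q q, P x & y = q + f * x].
Proof.
split=> [[q Qq [x Px <-]]|[q [x [Qq Px ->]]]]; first by exists q, x.
by exists q => //; exists x.
Qed.

Lemma submoduleD P x y : submodule P -> P x -> P y -> P (x + y).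
Proof. by move=> [_ h] Px Py; rewrite -[x]scale1r; apply: h. Qed.

Lemma submoduleM P f x : submodule P -> P x -> P (f * x).
Proof. by move=> [P0 h] Px; rewrite -[f * x]addr0; apply: (h f x 0). Qed.

Lemma submoduleB P x y : submodule P -> P x -> P y -> P (x - y).
Proof.
by move=> hP Px Py; rewrite -mulN1r; apply: submoduleD => //; apply: submoduleM.
Qed.

Lemma submodule_sum P (I : Type) (r : seq I) (B : pred I) (F : I -> R) :
  submodule P -> (forall i, B i -> P (F i)) -> P (\sum_(i <- r | B i) F i).
Proof.
move=> hP h; apply: (big_ind (P : R -> Prop)) => //; first by case: hP.
by move=> x y; apply: submoduleD.
Qed.

Lemma submodule_add_multiples Q f P :
  submodule Q -> submodule P -> submodule (add_multiples Q f P).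
Proof.
move=> hQ hP; split.
  by apply/add_multiplesP; exists 0, 0; rewrite mulr0 addr0; split=> //;
     [case: hQ|case: hP].
move=> a _ _ /add_multiplesP[q [x [Qq Px ->]]] /add_multiplesP[q' [x' [Qq' Px' ->]]].
apply/add_multiplesP; exists (a * q + q'), (a * x + x'); split.
- by apply: submoduleD => //; apply: submoduleM.
- by apply: submoduleD => //; apply: submoduleM.
- by rewrite /GRing.scale /= !mulrDr [f * (a * x)]mulrCA addrACA.
Qed.

Lemma sub_add_multiples Q f P x : submodule P -> Q x -> add_multiples Q f P x.
Proof.
move=> [P0 _] Qx; apply/add_multiplesP; exists x, 0.
by rewrite mulr0 addr0.
Qed.

Lemma mul_add_multiples Q f P x : submodule Q -> P x -> add_multiples Q f P (f * x).
Proof.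
by move=> [Q0 _] Px; apply/add_multiplesP; exists 0, x; rewrite add0r.
Qed.

(* As [regular_seq], without the requirement that the last quotient is nonzero,
   so that the notion is inherited by zero modules and by extensions. *)
Fixpoint weakly_regular P Q s : Prop :=
  if s is f :: s' then
    regular_elt P Q f /\ weakly_regular P (add_multiples Q f P) s'
  else True.

(** The hypotheses on [c] say that multiplication by [c] induces an isomorphism from [P / Q] onto
    [P' / Q']; it persists modulo each entry of [s]. *)
Lemma weakly_regular_iso c P Q P' Q' s :
  submodule P -> submodule Q -> submodule P' -> submodule Q' ->
  (forall x, P x -> P' (c * x)) ->
  (forall y, P' y -> exists2 x, P x & Q' (y - c * x)) ->
  (forall x, P x -> Q' (c * x) <-> Q x) ->
  weakly_regular P Q s -> weakly_regular P' Q' s.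
Proof.
move=> hP; move=> + hP' +; elim: s Q Q' => //= f s IH Q Q' hQ hQ' PP' P'P eqQ [reg wreg].
have P'0 : P' 0 by rewrite -(mulr0 c); apply: PP'; case: hP.
split.
  move=> y P'y; rewrite /GRing.scale /= => Qfy.
  have [x Px Qyx] := P'P y P'y.
  rewrite -(subrK (c * x) y); apply: submoduleD => //.
  apply/eqQ => //; apply: reg => //; rewrite /GRing.scale /=.
  apply/eqQ; first exact: submoduleM.
  have -> : c * (f * x) = f * y - f * (y - c * x) by rewrite mulrBr subKr (mulrCA c).
  by apply: submoduleB => //; apply: submoduleM.
have addl := sub_add_multiples.
apply: IH wreg => //.
- exact: submodule_add_multiples.
- exact: submodule_add_multiples.
- move=> y P'y; have [x Px Qyx] := P'P y P'y; exists x => //.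
  by apply/add_multiplesP; exists (y - c * x), 0; rewrite mulr0 addr0.
- move=> x Px; split.
    move=> /add_multiplesP[q [y [Qq P'y ex]]]; have [u Pu Qu] := P'P y P'y.
    apply/add_multiplesP; exists (x - f * u), u; split=> //; last by rewrite subrK.
    apply/eqQ; first by apply: submoduleB => //; apply: submoduleM.
    rewrite mulrBr ex (mulrCA c) -addrA -mulrBr.
    by apply: submoduleD => //; apply: submoduleM.
  move=> /add_multiplesP[q [y [Qq Py ex]]]; apply/add_multiplesP.
  exists (c * q), (c * y); split; last by rewrite ex mulrDr (mulrCA c).
    apply/eqQ => //; suff -> : q = x - f * y.
      by apply: submoduleB => //; apply: submoduleM.
    by rewrite ex addrK.
  exact: PP'.
Qed.

(** Regularity of [f] on [P / N] makes [Q + f N] the intersection of [N] and [Q + f P], so the exact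
    sequence of [N / Q], [P / Q] and [P / N] stays exact modulo [f]. *)
Lemma weakly_regular_ext P N Q s :
  submodule P -> submodule N -> submodule Q ->
  (forall x, Q x -> N x) -> (forall x, N x -> P x) ->
  weakly_regular N Q s -> weakly_regular P N s -> weakly_regular P Q s.
Proof.
move=> hP; elim: s N Q => //= f s IH N Q hN hQ QN NP [rNQ wNQ] [rPN wPN].
split.
  move=> x Px Qfx; apply: rNQ => //; apply: rPN => //; exact: QN.
have sumN := submodule_add_multiples f hN hP.
have sumQ := submodule_add_multiples f hQ hP.
apply: (IH (add_multiples N f P)) => //.
- move=> _ /add_multiplesP[q [x [Qq Px ->]]]; apply/add_multiplesP.
  by exists q, x; split=> //; apply: QN.
- move=> _ /add_multiplesP[q [x [Nq Px ->]]].
  by apply: submoduleD => //; [apply: NP|apply: submoduleM].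
(* This is the isomorphism from [N / (Q + f N)] onto [(N + f P) / (Q + f P)]. *)
apply: (@weakly_regular_iso 1 N (add_multiples Q f N)) wNQ => //.
- exact: submodule_add_multiples.
- by move=> x Nx; rewrite mul1r; apply: sub_add_multiples.
- move=> _ /add_multiplesP[x [y [Nx Py ->]]]; exists x => //.
  by rewrite mul1r addrAC subrr add0r; apply: mul_add_multiples.
- move=> x Nx; rewrite mul1r; split=> /add_multiplesP[q [y [Qq Ny ex]]];
    apply/add_multiplesP; exists q, y; split=> //; last exact: NP.
  apply: rPN => //; rewrite /GRing.scale /=.
  have -> : f * y = x - q by rewrite ex addrAC subrr add0r.
  by apply: submoduleB => //; apply: QN.
Qed.

Lemma weakly_regular_congr P Q Q' s :
  submodule P -> submodule Q -> submodule Q' -> (forall x, Q x <-> Q' x) ->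
  weakly_regular P Q s -> weakly_regular P Q' s.
Proof.
move=> hP hQ hQ' QQ'; apply: (@weakly_regular_iso 1) => // [x|y Py|x _].
- by rewrite mul1r.
- by exists y; rewrite ?mul1r ?subrr //; case: hQ'.
- by rewrite mul1r; symmetry.
Qed.

Lemma weakly_regular_zero P Q s : submodule P -> submodule Q ->
  (forall x, P x -> Q x) -> weakly_regular P Q s.
Proof.
move=> hP; elim: s Q => //= f s IH Q hQ PQ; split; first by move=> x /PQ.
apply: IH => [|x Px]; first exact: submodule_add_multiples.
by apply: sub_add_multiples => //; apply: PQ.
Qed.

(* Nakayama's lemma is replaced by a set [K] that contains [Q] and [s P]
   but not [P]. *)
Lemma weakly_regular_regular_seq (K : set R^o) P Q s :
  submodule P -> submodule Q -> (forall x, Q x -> P x) ->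
  (forall x, Q x -> K x) -> (forall x y, K x -> K y -> K (x + y)) ->
  (forall f x, f \in s -> P x -> K (f * x)) ->
  (exists2 x, P x & ~ K x) ->
  weakly_regular P Q s -> regular_seq P Q s.
Proof.
move=> hP + + + KD + [x0 Px0 Kx0]; elim: s Q => /= [|f s IH] Q hQ QP QK sK.
  by move=> _; split=> // PQ; apply/Kx0/QK/PQ.
move=> [rPQ wPQ]; split=> //.
have Kf x : P x -> K (f * x) by move=> Px; apply: sK; rewrite ?mem_head.
apply: IH wPQ.
- exact: submodule_add_multiples.
- move=> _ /add_multiplesP[q [x [Qq Px ->]]].
  by apply: submoduleD => //; [apply: QP|apply: submoduleM].
- move=> _ /add_multiplesP[q [x [Qq Px ->]]].
  by apply: KD; [apply: QK|apply: Kf].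
- by move=> g x gs; apply: sK; rewrite inE gs orbT.
Qed.

(* The common core of strict chains of primes and of regular sequences: each
   entry of [s] is a nonzerodivisor modulo an ideal and lies in the next one. *)
Fixpoint flag (J : set R) s : Prop :=
  ideal J /\
  if s is f :: s' then
    (forall x, J (f * x) -> J x) /\
    exists J' : set R, [/\ forall x, J x -> J' x, J' f & flag J' s']
  else ~ J 1.

Lemma flag_ideal J s : flag J s -> ideal J.
Proof. by case: s => [|f s] []. Qed.

(** Each entry of [s] is chosen in [p i.+1] outside [p i]; primality makes it a nonzerodivisor
    modulo [p i]. *)
Lemma prime_chain_flag (I : set R) (d : nat) (p : nat -> set R) :
  prime_chain I d p ->
  exists J s, [/\ forall x, I x -> J x, size s = d & flag J s].
Proof.
move=> [hp lt]; exists (p 0%N).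
have Ip x : I x -> p 0%N x by have [_] := hp 0%N isT; apply.
suff [s ss fs] : exists2 s, size s = d & flag (p 0%N) s by exists s; split.
have {Ip I} hp i : (i <= d)%N -> prime_ideal (p i) by move/hp => [].
elim: d p hp lt => [|d IH] p hp lt.
  by exists [::]; case: (hp 0%N).
have [|i id|s ss fs] := IH (fun i => p i.+1).
- by move=> i id; apply: hp.
- exact: lt.
have [sub nsub] := lt 0%N isT.
have [p0 _ p0M] := hp 0%N isT.
have [a p1a p0a] : exists2 a, p 1%N a & ~ p 0%N a.
  apply: contrapT => h; apply: nsub => a pa.
  by apply: contrapT => npa; apply: h; exists a.
exists (a :: s); first by rewrite /= ss.
by split=> //; split=> [x /p0M[]|] //; exists (p 1%N).
Qed.

(** For [x] in [P] outside [Q + s P], the colon ideals of [x] into the successive submodules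
    [Q + (f_1, ..., f_i) P] form the flag. *)
Lemma regular_seq_flag P Q s :
  submodule P -> submodule Q -> regular_seq P Q s ->
  exists2 x, P x & flag (fun g => Q (g * x)) s.
Proof.
move=> hP.
have colon_ideal Q' x : submodule Q' -> ideal (fun g : R => Q' (g * x)).
  move=> hQ'; split=> [|a g h Qg Qh]; first by rewrite mul0r; case: hQ'.
  rewrite /GRing.scale /= mulrDl -mulrA.
  by apply: submoduleD => //; apply: submoduleM.
elim: s Q => /= [|f s IH] Q hQ.
  move=> [QP nPQ].
  have [x Px Qx] : exists2 x, P x & ~ Q x.
    apply: contrapT => h; apply: nPQ => a pa.
    by apply: contrapT => npa; apply: h; exists a.
  by exists x => //; rewrite mul1r; split=> //; apply: colon_ideal.
move=> [rPQ /IH[|x Px fx]]; first exact: submodule_add_multiples.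
exists x => //; split; first exact: colon_ideal.
split=> [g|].
  by rewrite -mulrA; apply: rPQ; apply: submoduleM.
eexists; split; last exact: fx.
- by move=> g; apply: sub_add_multiples.
- exact: mul_add_multiples.
Qed.

End WeaklyRegular.

(** * Stanley-Reisner ideals and interval partitions *)

Section StanleyReisner.
Local Open Scope ring_scope.
Variables (k : fieldType) (n : nat).
Local Notation S := {mpoly k[n]}.
Implicit Types (m : 'X_{1..n}) (f g : S) (D : {set {set 'I_n}}) (F : {set 'I_n}).

Definition supp m : {set 'I_n} := [set i | m i != 0%N].

Lemma suppD m1 m2 : supp (m1 + m2)%MM = supp m1 :|: supp m2.
Proof. by apply/setP => i; rewrite !inE mnmDE addn_eq0 negb_and. Qed.

Lemma supp_mesym1 F : supp (mesym1 F) = F.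
Proof. by apply/setP => i; rewrite !inE mnmE; case: (i \in F). Qed.

Lemma mesym1_le F m : (mesym1 F <= m)%MM = (F \subset supp m).
Proof.
apply/mnm_lepP/subsetP => h i; have := h i; rewrite inE mnmE.
  by case: (i \in F) => //; rewrite lt0n.
by case: (i \in F) => // /(_ isT); rewrite lt0n.
Qed.

Lemma mcoeffM_eq0 f g m :
  (forall m1 m2, m = (m1 + m2)%MM -> f@_m1 * g@_m2 = 0) -> (f * g)@_m = 0.
Proof. by move=> h; rewrite mcoeffM big1 // => -[m1 m2] /= /eqP; apply: h. Qed.

Lemma mcoeffXM_eq0 F f m : ~~ (F \subset supp m) -> ('X_[mesym1 F] * f)@_m = 0.
Proof.
move=> nFm; apply: mcoeffM_eq0 => m1 m2 em; rewrite mcoeffX.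
case: eqP => [e|_]; last by rewrite mul0r.
by move: nFm; rewrite em -e suppD supp_mesym1 subsetUl.
Qed.

Lemma mcoeffXM F f m : ('X_[mesym1 F] * f)@_(m + mesym1 F)%MM = f@_m.
Proof. by rewrite mulrC addmC mcoeffMX. Qed.

Lemma divide_by_squarefree F g : exists f, forall m,
  ('X_[mesym1 F] * f)@_m = if F \subset supp m then g@_m else 0.
Proof.
exists (\sum_(m <- msupp g | F \subset supp m) g@_m *: 'X_[m - mesym1 F]).
move=> m; case: ifP => [Fm|/negbT]; last exact: mcoeffXM_eq0.
have {2}<- : (m - mesym1 F + mesym1 F)%MM = m by rewrite submK // mesym1_le.
rewrite -{1}(submK (m := mesym1 F) (m' := m)) ?mesym1_le // mcoeffXM.
rewrite raddf_sum /= (eq_bigr (fun i => if i == m then g@_m else 0)); last first.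
  move=> i Fi; rewrite mcoeffZ mcoeffX; have [->|im] := eqVneq i m.
    by rewrite eqxx mulr1.
  case: eqP => [e|]; last by rewrite mulr0.
  case/eqP: im; rewrite -(submK (m := mesym1 F) (m' := i)) ?mesym1_le //.
  by rewrite e submK // mesym1_le.
rewrite submK ?mesym1_le // big_mkcond /=.
case: (boolP (m \in msupp g)) => [mg|/memN_msupp_eq0 ->]; last first.
  by rewrite big1 // => i _; rewrite !if_same.
rewrite (bigD1_seq m) //= Fm eqxx big1 ?addr0 // => i /negbTE ->.
by rewrite if_same.
Qed.

(** The Stanley-Reisner ideal, given by coefficients instead of generators. For the void complex it
    is the whole ring, so [sr_ideal finset.set0] stands for [S] as a module. *)
Definition sr_ideal D : set S^o := fun f => forall m, supp m \in D -> f@_m = 0.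

Lemma sr_ideal_submodule D : simplicial_complex D -> submodule (sr_ideal D).
Proof.
move=> cD; split=> [m _|a x y hx hy m mD]; first by rewrite mcoeff0.
rewrite mcoeffD hy // addr0; apply: mcoeffM_eq0 => m1 m2 em.
rewrite hx ?mulr0 //; apply: cD mD _; by rewrite em suppD subsetUr.
Qed.

Lemma sr_idealS D D' f : D \subset D' -> sr_ideal D' f -> sr_ideal D f.
Proof. by move=> sD h m /(subsetP sD); apply: h. Qed.

Lemma sr_idealX D m : sr_ideal D 'X_[m] <-> supp m \notin D.
Proof.
split=> [h|mD m' m'D].
  by apply/negP => /h /eqP; rewrite mcoeffX eqxx oner_eq0.
by rewrite mcoeffX; case: eqP => // e; rewrite e m'D in mD.
Qed.

(** The prime generated by the variables outside [F]. *)
Definition face_ideal F := sr_ideal (powerset F).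

Lemma powerset_complex F : simplicial_complex (powerset F).
Proof. by move=> A B; rewrite !powersetE => AF /subset_trans; apply. Qed.

Lemma face_ideal_submodule F : submodule (face_ideal F).
Proof. exact/sr_ideal_submodule/powerset_complex. Qed.

Lemma face_ideal_mul F f g :
  face_ideal F (f * g) -> face_ideal F f \/ face_ideal F g.
Proof.
(* Substituting 0 for the variables outside [F] is a ring morphism into a domain, with kernel
   [face_ideal F]. *)
pose h (i : 'I_n) : S := if i \in F then 'X_i else 0.
have hX m : mmap1 h m = if supp m \subset F then 'X_[m] else 0.
  case: ifPn => [/subsetP mF|/subsetPn[i]].
    rewrite -[RHS]mmap1_id; apply: eq_bigr => i _; rewrite /h.
    case: ifPn => // iF; suff -> : m i = 0%N by [].
    by apply/eqP; apply: contraNT iF => mi; apply: mF; rewrite inE.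
  by rewrite inE => mi iF; rewrite /mmap1 (bigD1 i) //= /h (negbTE iF) expr0n
    (negbTE mi) mul0r.
have hE p m : (mmap (@mpolyC n k) h p)@_m = if supp m \subset F then p@_m else 0.
  rewrite /mmap raddf_sum /=.
  under eq_bigr do rewrite hX mcoeffCM.
  rewrite [in RHS](mpolyE p) raddf_sum /=; case: ifPn => mF.
    apply: eq_bigr => m' _; rewrite mcoeffZ; case: ifPn => // m'F.
    rewrite mcoeff0 mcoeffX; case: eqP => [e|_] //.
    by rewrite e mF in m'F.
  rewrite big1 // => m' _; case: ifPn => [m'F|_]; last by rewrite mcoeff0 mulr0.
  rewrite mcoeffX; case: eqP => [e|_]; last by rewrite mulr0.
  by rewrite -e m'F in mF.
have P p : face_ideal F p <-> mmap (@mpolyC n k) h p = 0.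
  split=> [hp|hp m].
    apply/mpolyP => m; rewrite hE mcoeff0; case: ifP => // mF.
    by apply: hp; rewrite powersetE.
  by rewrite powersetE => mF; have := hE p m; rewrite hp mcoeff0 mF.
rewrite !P rmorphM /= => /eqP; rewrite mulf_eq0 => /orP[] /eqP; by [left|right].
Qed.

Lemma face_ideal_prime F : @prime_ideal S (face_ideal F).
Proof.
split; [exact: face_ideal_submodule| |exact: face_ideal_mul].
move=> /(_ 0%MM); rewrite mcoeff1 eqxx => h.
suff /eqP : 1 = 0 :> k by rewrite oner_eq0.
apply: h; rewrite powersetE; apply/subsetP => i.
by rewrite inE mnm0E.
Qed.

Lemma sr_ideal_colon D (R F : {set 'I_n}) f : R \subset F ->
  (forall A : {set 'I_n}, R \subset A -> A \subset F -> A \in D) ->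
  sr_ideal D ('X_[mesym1 R] * f) -> face_ideal F f.
Proof.
move=> RF RFD h m; rewrite powersetE => mF.
rewrite -(mcoeffXM R); apply: h; rewrite suppD supp_mesym1.
by apply: RFD; rewrite ?subsetUr // subUset mF.
Qed.

Lemma mesymB_face F : face_ideal F (mesym n k #|F| - 'X_[mesym1 F]).
Proof.
rewrite mesymE (bigD1 F) //= addrAC subrr add0r.
apply: submodule_sum; first exact: face_ideal_submodule.
move=> A /andP[/eqP cA nA]; apply/sr_idealX; rewrite supp_mesym1 powersetE.
by apply: contra nA => sA; rewrite eqEcard sA cA /=.
Qed.

Lemma mesym_notin_face F : ~ face_ideal F (mesym n k #|F|).
Proof.
move=> h; have /sr_idealX : face_ideal F 'X_[mesym1 F].
  rewrite -[X in face_ideal F X](subKr (mesym n k #|F|)).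
  apply: (@submoduleB _ (face_ideal F)) => //.
    exact: face_ideal_submodule.
  exact: mesymB_face.
by rewrite supp_mesym1 powersetE subxx.
Qed.

Lemma sr_ideal_set0 f : sr_ideal finset.set0 f.
Proof. by move=> m; rewrite in_set0. Qed.

Lemma set0_complex : simplicial_complex (finset.set0 : {set {set 'I_n}}).
Proof. by move=> A B; rewrite in_set0. Qed.

(** The monomials with support in [[R, F]] form a basis of the quotient, and multiplication by the
    monomial of [R] maps [S / face_ideal F] isomorphically onto it. *)
Lemma weakly_regular_interval (R F : {set 'I_n}) D D' s :
  simplicial_complex D -> simplicial_complex D' -> R \subset F ->
  (forall A : {set 'I_n}, R \subset A -> A \subset F -> A \in D') ->
  D = D' :\: [set A : {set 'I_n} | (R \subset A) && (A \subset F)] ->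
  weakly_regular (sr_ideal finset.set0) (face_ideal F) s ->
  weakly_regular (sr_ideal D) (sr_ideal D') s.
Proof.
move=> cD cD' RF RFD' eD.
have RD : R \notin D by rewrite eD !inE subxx RF.
have interval A : A \in D' -> A \notin D -> (R \subset A) && (A \subset F).
  by move=> AD'; rewrite eD !inE AD' andbT negbK.
apply: (@weakly_regular_iso _ 'X_[mesym1 R]).
- exact/sr_ideal_submodule/set0_complex.
- exact: face_ideal_submodule.
- exact: sr_ideal_submodule.
- exact: sr_ideal_submodule.
- move=> f _; rewrite mulrC; apply: (submoduleM _ (sr_ideal_submodule cD)).
  by apply/sr_idealX; rewrite supp_mesym1.
- move=> g Dg; have [f hf] := divide_by_squarefree R g; exists f.
    exact: sr_ideal_set0.
  (* A support in [D'] that does not contain [R] is outside the interval, hence in [D], where [g]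
     has no terms. *)
  move=> m mD'; rewrite mcoeffB hf; case: ifPn => [_|nRm]; first by rewrite subrr.
  rewrite subr0; apply: Dg; apply: contraNT nRm => mD.
  by have /andP[] := interval _ mD' mD.
- move=> f _; split; first exact: sr_ideal_colon.
  move=> Ff m mD'; have [Rm|nRm] := boolP (R \subset supp m); last first.
    exact: mcoeffXM_eq0.
  rewrite -(submK (m := mesym1 R) (m' := m)) ?mesym1_le // mcoeffXM.
  apply: Ff; rewrite powersetE.
  have /andP[_ mF] : (R \subset supp m) && (supp m \subset F).
    by apply: interval => //; apply: contra RD => mD; apply: cD mD Rm.
  apply: subset_trans mF; apply/subsetP => i.
  by rewrite !inE mnmBE; apply: contra => /eqP->.
Qed.

(* The sets of [D'] outside [D] are partitioned into the intervals
   [[rho A, Phi (rho A)]], all with an upper end of size [d]. *)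
Definition interval_partition (rho Phi : {set 'I_n} -> {set 'I_n}) d D D' : Prop :=
  [/\ D \subset D',
      forall A, A \in D' :\: D ->
        [/\ rho A \subset A, A \subset Phi (rho A) & #|Phi (rho A)| = d],
      forall A B : {set 'I_n}, A \in D' :\: D -> rho A \subset B ->
        B \subset Phi (rho A) -> B \in D' :\: D /\ rho B = rho A
    & forall A B, A \in D' :\: D -> B \in D' :\: D -> A \subset B ->
        rho A \subset rho B].

(** Intervals are removed one at a time, each contributing a submodule isomorphic to some
    [S / face_ideal F]. *)
Lemma weakly_regular_interval_partition rho Phi d D D' s :
  (forall F, #|F| = d ->
     weakly_regular (sr_ideal finset.set0) (face_ideal F) s) ->
  simplicial_complex D -> simplicial_complex D' ->
  interval_partition rho Phi d D D' ->
  weakly_regular (sr_ideal D) (sr_ideal D') s.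
Proof.
move=> hs cD; have [N] := ubnP #|D' :\: D|; elim: N D' => // N IH D' ltN cD'.
move=> [sDD' bounds closed mono].
have [/eqP|[A0 A0D]] := set_0Vmem (D' :\: D).
  rewrite setD_eq0 => sD'D.
  apply: weakly_regular_zero; [exact: sr_ideal_submodule..|].
  by move=> f; apply: sr_idealS.
(* Maximality of [#|rho A|] ensures that removing the interval leaves a complex: a face above a
   member of the interval has a [rho] containing [R], hence equal to it, and so lies in the interval
   too. *)
case: (arg_maxnP (P := [pred A in D' :\: D]) (fun A => #|rho A|) A0D) => A /= AD maxA.
have [rhoA APhi cardPhi] := bounds A AD.
set R := rho A in rhoA APhi cardPhi maxA; set F := Phi R in APhi cardPhi.
have RFD (B : {set 'I_n}) : R \subset B -> B \subset F -> B \in D' :\: D /\ rho B = R.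
  exact: closed.
have RF : R \subset F := subset_trans rhoA APhi.
set D1 := D' :\: [set B : {set 'I_n} | (R \subset B) && (B \subset F)].
have cD1 : simplicial_complex D1.
  move=> B C; rewrite !inE => /andP[nB BD'] CB.
  have CD' : C \in D' := cD' _ _ BD' CB.
  rewrite CD' andbT; apply: contra nB => /andP[RC CF].
  have [CD rhoC] := RFD C RC CF.
  have BD : B \in D' :\: D.
    rewrite inE BD' andbT; move: CD; rewrite inE => /andP[+ _].
    by apply: contra => BD; apply: cD BD CB.
  have rhoB : rho B = R.
    apply/eqP; rewrite eq_sym eqEcard -{1}rhoC (mono C B) //=.
    exact: maxA.
  by have [] := bounds B BD; rewrite rhoB => -> ->.
have sDD1 : D \subset D1.
  apply/subsetP => B BD; rewrite !inE (subsetP sDD') // andbT.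
  by apply/negP => /andP[RB BF]; have [] := RFD B RB BF; rewrite inE BD.
have sub1 B : B \in D1 :\: D -> B \in D' :\: D.
  by rewrite !inE => /and3P[-> _ ->].
have ltN1 : (#|D1 :\: D| < N)%N.
  apply: (@leq_trans #|D' :\: D|); last by rewrite -ltnS.
  apply: proper_card; apply/properP; split; first by apply/subsetP.
  by exists A; rewrite // !inE rhoA APhi /= andbF.
apply: (weakly_regular_ext (N := sr_ideal D1)); try exact: sr_ideal_submodule.
- by move=> f; apply: sr_idealS; apply: subsetDl.
- by move=> f; apply: sr_idealS.
- apply: (weakly_regular_interval (R := R) (F := F)) => //; last exact: hs.
  by move=> B RB BF; have [] := RFD B RB BF; rewrite inE => /andP[].
apply: IH => //; split=> //.
- by move=> B /sub1; apply: bounds.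
- move=> B C BD1 rBC CPhi; have BD := sub1 _ BD1.
  have [CD rC] := closed B C BD rBC CPhi; split=> //.
  move: CD; rewrite !inE => /andP[-> ->]; rewrite andbT /=.
  apply/negP => /andP[RC CF]; have [_ rC'] := RFD C RC CF.
  move: BD1; rewrite !inE => /andP[_ /andP[/negP[]]].
  by have [] := bounds B BD; rewrite -rC rC' => -> ->.
- by move=> B C /sub1 BD /sub1 CD; apply: mono.
Qed.

(** * The boundary of a simplex and elementary symmetric polynomials *)

Lemma simplex_boundary_partition F d : #|F| = d.+1 ->
  exists rho Phi,
    interval_partition rho Phi d finset.set0 (powerset F :\ F).
Proof.
move=> cF.
(* Let [a] be the first element of [F] missing from [A]. Then [rho A] is the part of [F] before [a],
   and [Phi (rho A)] is [F] without [a]: the standard shelling of the boundary. *)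
pose rho (A : {set 'I_n}) :=
  [set i in F | [forall j in F, (j <= i)%N ==> (j \in A)]].
pose Phi (B : {set 'I_n}) :=
  [set i in F | (i \in B) || [exists j in F, (j < i)%N && (j \notin B)]].
pose first_missing (A : {set 'I_n}) a :=
  [/\ a \in F, a \notin A & forall j, j \in F -> (j < a)%N -> j \in A].
have rhoE A a : first_missing A a -> rho A = [set i in F | (i < a)%N].
  move=> [aF aA amin]; apply/setP => i; rewrite !inE.
  case iF : (i \in F) => //=; apply/forall_inP/idP => [h|ia j jF].
    by rewrite ltnNge; apply: contra aA => ai; apply: (implyP (h a aF)).
  by apply/implyP => ji; apply: amin => //; apply: leq_ltn_trans ia.
have PhiE (a : 'I_n) : a \in F -> Phi [set i in F | (i < a)%N] = F :\ a.
  move=> aF; apply/setP => i; rewrite !inE.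
  case iF : (i \in F); rewrite ?andbF //= andbT.
  apply/orP/idP => [[ia|/exists_inP[j jF]]|].
  - by rewrite -val_eqE neq_ltn ia.
  - rewrite inE jF /= -leqNgt => /andP[ji aj].
    by rewrite -val_eqE neq_ltn (leq_ltn_trans aj ji) orbT.
  - rewrite -val_eqE neq_ltn => /orP[|ai]; first by left.
    by right; apply/exists_inP; exists a; rewrite // inE aF ltnn ai.
have first_missingP A : A \in powerset F :\ F -> exists a, first_missing A a.
  rewrite !inE => /andP[AF sAF].
  have /subsetPn[b bF bA] : ~~ (F \subset A) by move: AF; rewrite eqEsubset sAF.
  have Pb : [pred i | (i \in F) && (i \notin A)] b by rewrite /= bF.
  case: (arg_minnP (fun i : 'I_n => i : nat) Pb) => a /= /andP[aF aA] amin.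
  exists a; split=> // j jF ja; apply: contraLR ja => jA.
  by rewrite -leqNgt; apply: amin; rewrite jF.
exists rho, Phi; rewrite /interval_partition setD0; split.
- exact: sub0set.
- move=> A AD; have [a fa] := first_missingP A AD.
  have [aF aA amin] := fa; rewrite (rhoE A a fa) PhiE //.
  move: AD; rewrite !inE => /andP[_ sAF]; split.
  + by apply/subsetP => i; rewrite inE => /andP[]; apply: amin.
  + by rewrite subsetD1 sAF.
  + by apply/eqP; rewrite -eqSS -cF (cardsD1 a F) aF.
- move=> A B AD; have [a fa] := first_missingP A AD.
  have [aF aA amin] := fa; rewrite (rhoE A a fa) PhiE // => sB.
  rewrite subsetD1 => /andP[BF aB]; split.
    by rewrite !inE BF andbT; apply: contraNneq aB => ->.
  apply: rhoE; split=> // j jF ja; apply: (subsetP sB).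
  by rewrite inE jF.
- move=> A B _ _ AB; apply/subsetP => i; rewrite !inE => /andP[-> /forall_inP h] /=.
  by apply/forall_inP => j jF; apply/implyP => ji; apply/(subsetP AB)/(implyP (h j jF)).
Qed.

(** Degrees decrease because the first entry cuts a simplex down to its boundary, whose intervals
    have upper ends smaller by one. *)
Fixpoint esyms d : seq S :=
  if d is d'.+1 then mesym n k d :: esyms d' else [::].

Lemma size_esyms d : size (esyms d) = d.
Proof. by elim: d => //= d ->. Qed.

Lemma esyms_irrelevant d f : f \in esyms d -> f@_0%MM = 0.
Proof.
elim: d => //= d IH; rewrite inE => /orP[/eqP->|/IH//].
rewrite mesymE raddf_sum big1 //= => A /eqP cA; rewrite mcoeffX.
case: eqP => // /(congr1 supp); rewrite supp_mesym1 => A0.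
have : A = finset.set0 by rewrite A0; apply/setP => i; rewrite !inE mnm0E.
by move=> e; rewrite e cards0 in cA.
Qed.

Lemma mesym_boundary F x :
  sr_ideal (powerset F :\ F) x <->
  add_multiples (face_ideal F) (mesym n k #|F|) (sr_ideal finset.set0) x.
Proof.
have cB : simplicial_complex (powerset F :\ F).
  move=> A B; rewrite !inE => /andP[AF sA] BA; rewrite (subset_trans BA sA) andbT.
  by apply: contra AF => /eqP e; rewrite eqEsubset sA -e.
have hF := face_ideal_submodule F; have hB := sr_ideal_submodule cB.
have FB f : face_ideal F f -> sr_ideal (powerset F :\ F) f.
  by apply: sr_idealS; apply: subsetDl.
have eF : face_ideal F (mesym n k #|F| - _) := @mesymB_face F.
set e := mesym n k #|F| in eF *.
split=> [Bx|/add_multiplesP[q [g [Fq _ ->]]]]; last first.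
  apply: (submoduleD hB); first exact: FB.
  rewrite mulrC; apply: (submoduleM _ hB); rewrite -(subrK 'X_[mesym1 F] e).
  apply: (submoduleD hB); first exact: FB.
  by apply/sr_idealX; rewrite supp_mesym1 !inE eqxx.
(* The terms of [x] divisible by the monomial of [F] supply [f]; that monomial equals [e] modulo
   [face_ideal F], which already contains the other terms of [x]. *)
have [f hf] := divide_by_squarefree F x; apply/add_multiplesP.
exists (x - e * f), f; split; [|exact: sr_ideal_set0|by rewrite subrK].
have -> : x - e * f = (x - 'X_[mesym1 F] * f) - f * (e - 'X_[mesym1 F]).
  by rewrite mulrBr !(mulrC f) opprB addrA subrK.
apply: (submoduleB hF); last exact: (submoduleM _ hF).
move=> m; rewrite powersetE mcoeffB hf => mF.
case: ifPn => [_|nFm]; first by rewrite subrr.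
rewrite Bx ?subr0 // !inE mF andbT; apply: contraNneq nFm => ->.
exact: subxx.
Qed.

(* Modulo [face_ideal F], the top symmetric polynomial is the product of the
   variables of [F], whose zero locus is the boundary of the simplex on [F]. *)
Lemma weakly_regular_face d F : #|F| = d ->
  weakly_regular (sr_ideal finset.set0) (face_ideal F) (esyms d).
Proof.
elim: d F => //= d IH F cF; split.
  move=> x _ /face_ideal_mul[]//; rewrite -cF => eF.
  by have := mesym_notin_face eF.
have [rho [Phi part]] := simplex_boundary_partition cF.
have cB : simplicial_complex (powerset F :\ F).
  move=> A B; rewrite !inE => /andP[AF sA] BA; rewrite (subset_trans BA sA) andbT.
  by apply: contra AF => /eqP e; rewrite eqEsubset sA -e.
have h0 := sr_ideal_submodule set0_complex; have hB := sr_ideal_submodule cB.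
apply: (weakly_regular_congr h0 hB).
- by apply: submodule_add_multiples h0; exact: face_ideal_submodule.
- by move=> x; rewrite mesym_boundary cF.
- exact: weakly_regular_interval_partition IH set0_complex cB part.
Qed.

(** * Bounding the length of a flag by counting monomials *)

Lemma unit_ideal (J : set S) c : @ideal S J -> ~ J 1 -> J c%:MP -> c = 0.
Proof.
move=> hJ J1 Jc; apply/eqP/negPn/negP => c0; apply: J1.
have -> : 1 = c^-1%:MP * c%:MP :> S by rewrite -mpolyCM mulVf.
exact: (submoduleM _ hJ).
Qed.

Fixpoint exponents (M r : nat) : finType :=
  if r is r'.+1 then ('I_M * exponents M r')%type : finType else unit.

Lemma card_exponents M r : #|exponents M r| = (M ^ r)%N.
Proof. by elim: r => [|r IH]; rewrite ?card_unit //= card_prod card_ord IH expnS. Qed.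

Fixpoint monomial M (s : seq S) : exponents M (size s) -> S :=
  match s return exponents M (size s) -> S with
  | [::] => fun=> 1
  | f :: s' => fun p => f ^+ p.1 * monomial p.2
  end.

(** Modulo [J'] only [g 0] survives, so it vanishes; then [f] is cancelled modulo [J] and the
    argument repeats. *)
Lemma flag_power_sum (J J' : set S) f M (g : nat -> S) :
  @ideal S J -> @ideal S J' ->
  (forall x, J (f * x) -> J x) -> (forall x, J x -> J' x) -> J' f ->
  (forall i, (i < M)%N -> J' (g i) -> g i = 0) ->
  J (\sum_(i < M) f ^+ i * g i) -> forall i, (i < M)%N -> g i = 0.
Proof.
move=> hJ hJ' reg JJ' J'f; elim: M g => // M IH g hg.
rewrite big_ord_recl expr0 mul1r.
under eq_bigr do rewrite /= exprS -mulrA.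
rewrite -mulr_sumr => Jsum.
have g0 : g 0%N = 0.
  apply: hg => //; rewrite -[g 0%N](addrK (f * \sum_(i < M) f ^+ i * g i.+1)).
  apply: (submoduleB hJ'); first exact: JJ'.
  by rewrite mulrC; apply: (submoduleM _ hJ').
move: Jsum; rewrite g0 add0r => /reg Jsum.
case=> [|i] // iM; apply: (IH (fun i => g i.+1)) => // j jM.
exact: hg.
Qed.

(** Grouping by powers of the first entry reduces this to [flag_power_sum], whose hypothesis on
    coefficients is the induction hypothesis for the rest of [s]. *)
Lemma flag_independent M (J : set S) (s : seq S) (c : exponents M (size s) -> k) :
  flag J s -> J (\sum_t (c t)%:MP * monomial t) -> forall t, c t = 0.
Proof.
elim: s J c => [|f s IH] J c /= [hJ].
  move=> J1; rewrite (bigD1 tt) //= big1 => [|[]] //; rewrite mulr1 addr0.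
  by move=> Jc []; apply: unit_ideal Jc.
move=> [reg [J' [JJ' J'f fl]]].
pose g i : S := if insub i is Some i' then
  \sum_t (c (i', t))%:MP * monomial t else 0.
have gE (i : 'I_M) : g i = \sum_t (c (i, t))%:MP * monomial t.
  by rewrite /g valK.
have -> : \sum_t (c t)%:MP * (f ^+ t.1 * monomial t.2) =
    \sum_(i < M) f ^+ i * g i.
  under [RHS]eq_bigr do rewrite gE mulr_sumr.
  by rewrite pair_bigA; apply: eq_bigr => -[i t] _ /=; rewrite mulrCA.
have hJ' := flag_ideal fl.
have g0 i : (i < M)%N -> J' (g i) ->
    forall t, if insub i is Some i' then c (i', t) = 0 else True.
  by move=> iM; rewrite /g insubT /= => Jg t; apply: IH fl Jg t.
move=> /(flag_power_sum hJ hJ' reg JJ' J'f) h [i t].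
have := g0 i (ltn_ord i); rewrite valK; apply.
rewrite h //; first by case: hJ'.
move=> j jM /(g0 j jM); rewrite /g insubT => e.
by rewrite big1 // => u _; rewrite e mpolyC0 mul0r.
Qed.

Definition degree_le (d : nat) f := forall m, f@_m != 0 -> (mdeg m <= d)%N.

Lemma degree_leM d e f g :
  degree_le d f -> degree_le e g -> degree_le (d + e) (f * g).
Proof.
move=> df dg m; rewrite -mcoeff_msupp => /msuppM_le/allpairsP[[m1 m2] /= []].
rewrite !mcoeff_msupp => /df h1 /dg h2 ->.
by rewrite mdegD leq_add.
Qed.

Lemma degree_le1 : degree_le 0 1.
Proof.
by move=> m; rewrite mcoeff1; case: (m =P 0%MM) => [->|]; rewrite ?mdeg0 // eqxx.
Qed.

Lemma degree_le_trans d e f : (d <= e)%N -> degree_le d f -> degree_le e f.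
Proof. by move=> de h m /h /leq_trans; apply. Qed.

Lemma degree_leX d f i : degree_le d f -> degree_le (i * d) (f ^+ i).
Proof.
move=> df; elim: i => [|i IH]; first exact: degree_le1.
by rewrite exprS mulSn; apply: degree_leM.
Qed.

Lemma degree_le_monomial M b (s : seq S) (t : exponents M (size s)) :
  (forall f, f \in s -> degree_le b f) -> degree_le (size s * (M * b)) (monomial t).
Proof.
elim: s t => [|f s IH] /= t hs; first exact: degree_le1.
rewrite mulSn; apply: degree_leM; last first.
  by apply: IH => g gs; apply: hs; rewrite inE gs orbT.
apply: (@degree_le_trans (t.1 * b)); first by rewrite leq_mul2r ltnW ?orbT.
by apply: degree_leX; apply: hs; rewrite mem_head.
Qed.

Lemma degree_bound (s : seq S) : exists b, forall f, f \in s -> degree_le b f.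
Proof.
elim: s => [|f s [b hb]]; first by exists 0%N.
exists (maxn (msize f) b) => g; rewrite inE => /orP[/eqP->|/hb].
  move=> m; rewrite -mcoeff_msupp => /msize_mdeg_lt /ltnW h.
  by rewrite leq_max h.
by apply: degree_le_trans; rewrite leq_maxr.
Qed.

(** A code for monomials: a support, and a list of exponents in the order of its elements. It
    reaches every monomial of degree below [N] in at most [d] variables, so there are at most
    [2 ^ n * N ^ d] of these. *)
Definition mnm_of_tuple N d (p : {set 'I_n} * d.-tuple 'I_N) : 'X_{1..n} :=
  [multinom (if i \in p.1 then nth 0 [seq val j | j <- p.2] (index i (enum p.1))
             else 0)%N | i < n].

Lemma mnm_of_tupleP N d m : (mdeg m < N)%N -> (#|supp m| <= d)%N ->
  exists p : {set 'I_n} * d.-tuple 'I_N, mnm_of_tuple p = m.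
Proof.
move=> mN md; have N0 : (0 < N)%N by apply: leq_ltn_trans mN.
have miN i : (m i < N)%N.
  by apply: leq_ltn_trans mN; rewrite mdegE (bigD1 i) //= leq_addr.
pose e := [seq Ordinal (miN i) | i <- enum (supp m)].
have se : size (e ++ nseq (d - #|supp m|) (Ordinal N0)) == d.
  by rewrite size_cat size_nseq size_map -cardE subnKC.
exists (supp m, Tuple se); apply/mnmP => i; rewrite mnmE /=.
case: ifPn => [im|]; last by rewrite inE negbK => /eqP->.
have lti : (index i (enum (supp m)) < size (enum (supp m)))%N.
  by rewrite index_mem mem_enum.
rewrite map_cat nth_cat !size_map lti -map_comp (nth_map i) //=.
by rewrite nth_index // mem_enum.
Qed.

(* The monomials in [s] of bounded exponents span a space whose dimension grows
   like a power of the bound of exponent [size s], while modulo [J] the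
   polynomials of bounded degree have a dimension growing with exponent [d]. *)
Lemma flag_size d (J : set S) (s : seq S) : flag J s ->
  (forall f, (forall m, (#|supp m| <= d)%N -> f@_m = 0) -> J f) ->
  (size s <= d)%N.
Proof.
move=> fl hJ; rewrite leqNgt; apply/negP => ltds.
have [b hb] := degree_bound s.
(* Since [N <= M * (r * b).+1], this [C] gives [2 ^ n * N ^ d <= C * M ^ d < M ^ d.+1 <= M ^ r]. *)
pose r := size s; pose C := (2 ^ n * (r * b).+1 ^ d)%N.
pose M := C.+1; pose N := (r * (M * b)).+1.
suff : (M ^ r <= 2 ^ n * N ^ d)%N.
  apply/negP; rewrite -ltnNge.
  apply: (@leq_ltn_trans (C * M ^ d)).
    rewrite /C -mulnA leq_mul2l -expnMn; apply/orP; right.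
    have [->|d0] := posnP d; first by rewrite !expn0.
    by rewrite leq_exp2r // /N mulSn -mulnA (mulnC b) -add1n leq_add2r.
  apply: (@leq_trans (M ^ d.+1)); last by rewrite leq_pexp2l.
  by rewrite expnS ltn_mul2r expn_gt0 ltnSn.
pose T := ({set 'I_n} * d.-tuple 'I_N)%type.
have cT : #|{: T}| = (2 ^ n * N ^ d)%N.
  by rewrite card_prod card_tuple card_ord
    -cardsT -powersetT card_powerset cardsT card_ord.
rewrite -cT -(card_exponents M r) leqNgt; apply/negP => lt.
(* With more rows than columns, a nontrivial combination of the monomials in [s] has no term of
   degree below [N] in at most [d] variables. Larger degrees do not occur, so it lies in [J],
   against [flag_independent]. *)
pose A : 'M[k]_(#|exponents M r|, #|{: T}|) :=
  \matrix_(i, j) (monomial (s := s) (enum_val i))@_(mnm_of_tuple (enum_val j)).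
have : kermx A != 0.
  rewrite kermx_eq0 -row_leq_rank -ltnNge.
  exact: leq_ltn_trans (rank_leq_col A) lt.
case/rowV0Pn => u /sub_kermxP uA; case/negP.
pose c (t : exponents M r) := u 0 (enum_rank t).
suff c0 t : c t = 0.
  apply/eqP/rowP => i; rewrite mxE -[i]enum_valK; exact: c0.
apply: (flag_independent fl) t; apply: hJ => m md.
have [mN|Nm] := ltnP (mdeg m) N; last first.
  rewrite raddf_sum big1 //= => t _; rewrite mcoeffCM.
  suff /eqP -> : (monomial t)@_m == 0 by rewrite mulr0.
  apply/negPn/negP => /(degree_le_monomial hb); rewrite -/r.
  by rewrite leqNgt => /negP; apply.
have [p <-] := mnm_of_tupleP mN md.
have := congr1 (fun B : 'rV__ => B 0 (enum_rank p)) uA; rewrite !mxE => <-.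
rewrite raddf_sum (reindex (@enum_val _ predT)) /=; last first.
  by apply: onW_bij; apply: enum_val_bij.
apply: eq_bigr => i _; rewrite mxE mcoeffCM enum_rankK /c.
by rewrite enum_valK.
Qed.

(** * Dimension, depth and the filtration *)

Lemma face_ideal_chain F (I : set S) : (forall f, I f -> face_ideal F f) ->
  exists p, @prime_chain S I #|F| p.
Proof.
(* [T i] omits the first [i] elements of [F], so the face ideals increase from [face_ideal F]. *)
move=> IF; pose T i := [set x in drop i (enum F)].
have T0 : T 0%N = F by apply/setP => x; rewrite inE drop0 mem_enum.
have TS i : (i < #|F|)%N -> exists2 x, x \notin T i.+1 & T i = x |: T i.+1.
  move=> iF; have /card_gt0P[x0 _] := leq_ltn_trans (leq0n i) iF.
  rewrite cardE in iF.
  exists (nth x0 (enum F) i).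
    have := drop_uniq i (enum_uniq F).
    by rewrite inE (drop_nth x0 iF) => /andP[].
  by apply/setP => x; rewrite !inE (drop_nth x0 iF) inE.
exists (fun i => face_ideal (T i)); split=> i iF.
  split; first exact: face_ideal_prime.
  move=> f /IF; apply: sr_idealS; rewrite powersetS -{1}T0.
  by apply/subsetP => x; rewrite !inE drop0; apply: mem_drop.
have [x xT TE] := TS i iF; split=> [f|].
  by apply: sr_idealS; rewrite powersetS TE subsetUr.
move=> /(_ 'X_[mesym1 [set x]]) h.
have /h/sr_idealX : face_ideal (T i.+1) 'X_[mesym1 [set x]].
  by apply/sr_idealX; rewrite supp_mesym1 powersetE sub1set.
by rewrite supp_mesym1 powersetE sub1set TE setU11.
Qed.

(** The quotient has a basis of monomials in at most [d] variables, while multiples of [f] involve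
    only monomials in more than [d]. *)
Lemma annihilator_sparse rho Phi d D D' f :
  simplicial_complex D -> interval_partition rho Phi d D D' ->
  (forall m, (#|supp m| <= d)%N -> f@_m = 0) ->
  annihilator (sr_ideal D) (sr_ideal D') f.
Proof.
move=> cD [_ bounds _ _] hf x Dx m mD'.
have [mD|mD] := boolP (supp m \in D).
  exact: (submoduleM f (sr_ideal_submodule cD) Dx).
apply: mcoeffM_eq0 => m1 m2 em; rewrite hf ?mul0r //.
apply: (@leq_trans #|supp m|); first by rewrite subset_leq_card // em suppD subsetUl.
have [|_ mPhi <-] := bounds (supp m); first by rewrite inE mD mD'.
exact: subset_leq_card.
Qed.

Lemma mod_dim_interval_partition rho Phi d D D' A :
  simplicial_complex D -> simplicial_complex D' ->
  interval_partition rho Phi d D D' -> A \in D' :\: D ->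
  mod_dim (sr_ideal D) (sr_ideal D') d.
Proof.
move=> cD cD' part AD; have [sDD' bounds closed mono] := part.
have [rA APhi cPhi] := bounds A AD.
split; last first.
  move=> e p /prime_chain_flag[J [s [annJ <- fl]]].
  apply: (flag_size fl) => f hf; apply: annJ.
  exact: annihilator_sparse part hf.
(* The monomial of [rho A] lies in [sr_ideal D], and its cofactors into [sr_ideal D'] lie in
   [face_ideal (Phi (rho A))]; so this prime contains the annihilator. *)
rewrite -cPhi; apply: face_ideal_chain => f annf.
have rPhi : rho A \subset Phi (rho A) := subset_trans rA APhi.
apply: (sr_ideal_colon (D := D') rPhi) => [B rB BPhi|].
  by have [] := closed A B AD rB BPhi; rewrite inE => /andP[].
rewrite mulrC; apply: annf; apply/sr_idealX; rewrite supp_mesym1.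
by have [] := closed A (rho A) AD (subxx _) rPhi; rewrite inE => /andP[].
Qed.

Lemma cohen_macaulay_interval_partition rho Phi d D D' A :
  simplicial_complex D -> simplicial_complex D' ->
  interval_partition rho Phi d D D' -> A \in D' :\: D ->
  @cohen_macaulay k n (poly_gm k n) (sr_ideal D) (sr_ideal D').
Proof.
move=> cD cD' part AD; have hD := sr_ideal_submodule cD.
have hD' := sr_ideal_submodule cD'.
have [sDD' bounds closed mono] := part.
exists d; first exact: mod_dim_interval_partition part AD.
split; last first.
  move=> s [_ /(regular_seq_flag hD hD')[x Dx fl]].
  apply: (flag_size fl) => f hf.
  exact: (annihilator_sparse cD part hf) Dx.
exists (esyms d); last exact: size_esyms.
split; first exact: esyms_irrelevant.
case: (arg_minnP (P := [pred B in D' :\: D]) (fun B => #|B|) AD) => B /= BD minB.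
move: (BD); rewrite inE => /andP[nBD BD'].
(* The squarefree monomial of a minimal [B] cannot occur in [f * g] with [f] irrelevant and [g] in
   [sr_ideal D]: each of its proper divisors has support in [D]. *)
apply: (weakly_regular_regular_seq (K := fun f => f@_(mesym1 B) = 0) hD hD').
- by move=> f; apply: sr_idealS.
- by move=> f; apply; rewrite supp_mesym1.
- by move=> f g f0 g0; rewrite mcoeffD f0 g0 addr0.
- move=> f g /esyms_irrelevant f0 Dg; apply: mcoeffM_eq0 => m1 m2 em.
  have [->|m10] := eqVneq m1 0%MM; first by rewrite f0 mul0r.
  rewrite Dg ?mulr0 //; apply: contraT => m2D.
  have sm2 : supp m2 \subset B by rewrite -[B]supp_mesym1 em suppD subsetUr.
  have m2D' : supp m2 \in D' :\: D by rewrite inE m2D (cD' _ _ BD' sm2).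
  have eB : supp m2 = B by apply/eqP; rewrite eqEcard sm2 minB.
  case/eqP: m10; apply/mnmP => i; rewrite mnm0E; apply/eqP; apply: contraT => m1i.
  have := congr1 (fun m : 'X_{1..n} => m i) em; rewrite /= mnmDE mnmE.
  have iB : i \in B by rewrite -[B]supp_mesym1 em suppD !inE m1i.
  move: (iB); rewrite -{1}eB inE iB => m2i.
  by move: m1i m2i; case: (m1 i) => // a _; case: (m2 i) => // b _; rewrite addnS.
- exists 'X_[mesym1 B]; first by apply/sr_idealX; rewrite supp_mesym1.
  by rewrite mcoeffX eqxx; apply/eqP; rewrite oner_eq0.
- apply: weakly_regular_interval_partition cD cD' part.
  exact: weakly_regular_face.
Qed.

Lemma graded_sr_ideal D : simplicial_complex D ->
  @graded_submodule k n (poly_gm k n) (sr_ideal D).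
Proof.
move=> cD; split=> [|x Dx]; first exact: sr_ideal_submodule.
exists [seq Posz e | e <- iota 0 (msize (x : S))].
exists (fun d => if d is Posz e then pihomog mdeg e (x : S) else 0); split.
  case=> e /=; split=> //; first exact: pihomogP; last first.
    by move=> m _; rewrite mcoeff0.
  move=> m mD; rewrite pihomogE raddf_sum big1 //= => i _.
  rewrite mcoeffZ mcoeffX; case: eqP => [->|_]; last by rewrite mulr0.
  by rewrite Dx ?mul0r.
have -> : iota 0 (msize (x : S)) = index_iota 0 (msize (x : S)).
  by rewrite /index_iota subn0.
by rewrite big_map big_mkord; exact: pihomog_partitionE.
Qed.

Lemma quotient_krull_dim_inj (I : set S) d e :
  quotient_krull_dim I d -> quotient_krull_dim I e -> d = e.
Proof.
move=> [[p hp] maxd] [[q hq] maxe]; apply/eqP; rewrite eqn_leq.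
by rewrite (maxe _ _ hp) (maxd _ _ hq).
Qed.

(** Since [#|Phi (rho A)|] does not increase with [A], the faces where it is at least [j] form a
    complex. Consecutive attained values bound an interval partition with upper ends of one size. *)
Lemma sequentially_CM_sr_ideal (rho Phi : {set 'I_n} -> {set 'I_n}) D :
  simplicial_complex D ->
  (forall A, A \in D -> rho A \subset A /\ A \subset Phi (rho A)) ->
  (forall A B : {set 'I_n}, A \in D -> rho A \subset B -> B \subset Phi (rho A) ->
     B \in D /\ rho B = rho A) ->
  (forall A B : {set 'I_n}, B \in D -> A \subset B -> rho A \subset rho B) ->
  (forall A B : {set 'I_n}, B \in D -> A \subset B ->
     (#|Phi (rho B)| <= #|Phi (rho A)|)%N) ->
  @sequentially_CM k n (poly_gm k n) classical_sets.setT (sr_ideal D).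
Proof.
move=> cD bounds closed mono anti.
pose h (A : {set 'I_n}) := #|Phi (rho A)|.
(* Only attained values are listed, so that every quotient is nonzero. *)
pose ds := [seq j <- iota 0 n.+1 | [exists A in D, h A == j]].
have ds_sorted : sorted ltn ds by apply/sorted_filter/iota_ltn_sorted/ltn_trans.
have mem_ds j : (j \in ds) = [exists A in D, h A == j].
  rewrite mem_filter andb_idr // => /exists_inP[A _ /eqP <-].
  by rewrite mem_iota /= ltnS -[X in (_ <= X)%N](card_ord n) max_card.
have h_ds A : A \in D -> h A \in ds.
  by move=> AD; rewrite mem_ds; apply/exists_inP; exists A.
(* The default [n.+1] exceeds every value of [h]: past the end of [ds] the complex is void and the
   module is the whole ring. *)
pose dg i := nth n.+1 ds i.
have dg_lt i j : (i < j)%N -> (j < size ds)%N -> (dg i < dg j)%N.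
  move=> ij js; apply: (sorted_ltn_nth ltn_trans) => //.
  by rewrite inE (ltn_trans ij).
have dg_between i x : x \in ds -> (i < size ds)%N ->
    (dg i <= x)%N -> (x < dg i.+1)%N -> x = dg i.
  move=> xds; rewrite -(nth_index n.+1 xds) -/(dg _).
  have := xds; rewrite -index_mem; move: (index x ds) => j js si dij djs.
  case: (ltngtP j i) => [ji|ij|->] //; first by move: dij; rewrite leqNgt dg_lt.
  move: djs; rewrite ltnNge; case: (ltngtP i.+1 j) ij => // [ij _|-> _].
    by rewrite ltnW // dg_lt.
  by rewrite leqnn.
pose Dge j := [set A in D | (j <= h A)%N].
have cDge j : simplicial_complex (Dge j).
  move=> A B; rewrite !inE => /andP[AD jA] BA; rewrite (cD _ _ AD BA) /=.
  exact: leq_trans jA (anti _ _ AD BA).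
have dg_max i A : A \in D -> (size ds <= i)%N -> (h A < dg i)%N.
  move=> AD si; rewrite /dg nth_default // ltnS.
  by rewrite -[X in (_ <= X)%N](card_ord n) max_card.
have part i : (i < size ds)%N ->
    interval_partition rho Phi (dg i) (Dge (dg i.+1)) (Dge (dg i)).
  move=> si.
  have step A : A \in Dge (dg i) :\: Dge (dg i.+1) -> A \in D /\ h A = dg i.
    rewrite !inE => /andP[+ /andP[AD iA]]; rewrite AD /= -ltnNge => Ai.
    by split=> //; apply: dg_between => //; apply: h_ds.
  split.
  - apply/subsetP => A; rewrite !inE => /andP[-> /= le]; apply: leq_trans le.
    have [lt|ge] := ltnP i.+1 (size ds); first by rewrite ltnW // dg_lt.
    have : dg i \in ds by rewrite mem_nth.
    by rewrite mem_ds => /exists_inP[B BD /eqP <-]; rewrite ltnW // dg_max.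
  - by move=> A /step[AD hA]; have [] := bounds A AD.
  - move=> A B AD rB BPhi; have [A_D hA] := step A AD.
    have [BD rE] := closed A B A_D rB BPhi; split=> //.
    by move: AD; rewrite !inE A_D BD /h rE.
  - by move=> A B _ /step[BD _]; apply: mono.
have nonempty i : (i < size ds)%N ->
    exists A, A \in Dge (dg i) :\: Dge (dg i.+1).
  move=> si; have : dg i \in ds by rewrite mem_nth.
  rewrite mem_ds => /exists_inP[A AD /eqP hA]; exists A.
  rewrite !inE AD hA leqnn /= andbT -ltnNge.
  have [lt|ge] := ltnP i.+1 (size ds); first exact: dg_lt.
  by rewrite -hA dg_max.
exists (size ds), (fun i => sr_ideal (Dge (dg i))); split.
- congr sr_ideal; apply/setP => A; rewrite inE andb_idr // => AD.
  rewrite -(nth_index n.+1 (h_ds A AD)) -/(dg _).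
  have := h_ds A AD; rewrite -index_mem.
  by case: (index _ _) => [|j] js; rewrite ?leqnn // ltnW // dg_lt.
- apply/funext => f; apply/propext; split=> // _ m; rewrite inE => /andP[AD].
  by rewrite leqNgt dg_max.
- by move=> i _; apply: graded_sr_ideal.
- move=> i si; have [A AD] := nonempty i si; split; last first.
    exact: cohen_macaulay_interval_partition (part i si) AD.
  have [sD _ _ _] := part i si; split=> [f|]; first exact: sr_idealS.
  move: AD; rewrite inE => /andP[nAD AD].
  move=> /(_ 'X_[mesym1 A]) sub.
  have /sub/sr_idealX : sr_ideal (Dge (dg i.+1)) 'X_[mesym1 A].
    by apply/sr_idealX; rewrite supp_mesym1.
  by rewrite supp_mesym1 AD.
- move=> i si d e; have si' := ltnW si.
  have [A AD] := nonempty i si'; have [B BD] := nonempty i.+1 si.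
  have dimA := mod_dim_interval_partition (cDge _) (cDge _) (part i si') AD.
  have dimB := mod_dim_interval_partition (cDge _) (cDge _) (part i.+1 si) BD.
  move=> /(quotient_krull_dim_inj dimA) <- /(quotient_krull_dim_inj dimB) <-.
  exact: dg_lt.
Qed.

End StanleyReisner.

(** * The intervals of independent sets *)

Section DominatedGraph.
Variable G : sgraph.
Implicit Types (A B R Z : {set G}).

Definition free_in Z R : {set G} := [set z in Z | [forall r in R, ~~ adj r z]].

(** A vertex [w] gained in passing from [A] to [B] is traded for a vertex of [Z] that it dominates,
    which is free for [A] but not for [B]. Independence of [B] makes the trade injective. *)
Lemma free_in_card Z A B :
  (forall w, w \notin Z -> exists2 z, z \in Z & dominates w z) ->
  B \in independence_complex G -> A \subset B ->
  (#|(B :\: Z) :|: free_in Z (B :\: Z)| <= #|(A :\: Z) :|: free_in Z (A :\: Z)|)%N.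
Proof.
move=> dom iB AB.
have /choice[f hf] w : exists z, w \notin Z -> z \in Z /\ dominates w z.
  have [wZ|wZ] := boolP (w \in Z); first by exists w.
  by have [z zZ wz] := dom w wZ; exists z.
set PB := _ :|: _; set PA := _ :|: _.
rewrite -(cardsID PA PB) -(cardsID PB PA) setIC leq_add2l.
have PBA w : w \in PB :\: PA -> [/\ w \in B, w \notin A & w \notin Z].
  rewrite !inE negb_or negb_and negbK => /andP[/andP[wA fA] /orP[/andP[wZ wB]|]].
    by rewrite (negbTE wZ) /= in wA; split.
  move=> /andP[wZ /forall_inP fB]; move: fA; rewrite wZ /= => /negP[].
  apply/forall_inP => r; rewrite inE => /andP[rZ rA].
  by apply: fB; rewrite inE rZ (subsetP AB).
have finj : {in PB :\: PA &, injective f}.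
  move=> v w /PBA[vB _ vZ] /PBA[wB _ wZ] e.
  have [_ [vz _]] := hf v vZ; have [_ [_ domw]] := hf w wZ.
  have [|//|vw] := domw v; first by rewrite -e.
  by move/independentP: iB => /(_ v w vB wB); rewrite vw.
rewrite -(card_in_imset finj); apply: subset_leq_card.
apply/subsetP => _ /imsetP[w /PBA[wB wA wZ] ->].
have [fZ [wf domf]] := hf w wZ.
rewrite !inE fZ /=; apply/andP; split.
  apply/negP => /forall_inP /(_ w); rewrite inE wZ wB wf => h.
  by have := h isT.
apply/forall_inP => r; rewrite inE => /andP[_ rA].
apply/negP => /domf[rw|rw]; first by rewrite -rw rA in wA.
by move/independentP: iB => /(_ r w (subsetP AB _ rA) wB); rewrite rw.
Qed.

Lemma independent_interval Z A B : Z \in independence_complex G ->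
  A \in independence_complex G ->
  A :\: Z \subset B -> B \subset (A :\: Z) :|: free_in Z (A :\: Z) ->
  B \in independence_complex G /\ B :\: Z = A :\: Z.
Proof.
move=> /independentP iZ /independentP iA sB Bs.
have inB x : x \in B -> (x \in A :\: Z) || (x \in free_in Z (A :\: Z)).
  by move/(subsetP Bs); rewrite !inE.
split.
  apply/independentP => x y /inB hx /inB hy; move: hx hy.
  case/orP => [xA|xF] /orP[yA|yF].
  - by apply: iA; [move: xA|move: yA]; rewrite inE => /andP[].
  - by move: yF; rewrite inE => /andP[_ /forall_inP]; apply.
  - by move: xF; rewrite inE adj_sym => /andP[_ /forall_inP]; apply.
  - by move: xF yF; rewrite !inE => /andP[xZ _] /andP[yZ _]; apply: iZ.
apply/setP => x; apply/idP/idP => [|xA].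
  rewrite inE => /andP[xZ /inB /orP[]] //.
  by rewrite inE (negbTE xZ).
by rewrite inE (subsetP sB) // andbT; move: xA; rewrite inE => /andP[].
Qed.

Lemma independent_sub_free Z A : A \in independence_complex G ->
  A \subset (A :\: Z) :|: free_in Z (A :\: Z).
Proof.
move=> /independentP iA; apply/subsetP => x xA; rewrite !inE xA andbT.
case: (boolP (x \in Z)) => //= xZ; apply/forall_inP => r.
by rewrite inE => /andP[_ rA]; apply: iA.
Qed.

End DominatedGraph.

(** * The edge ideal as a Stanley-Reisner ideal *)

Section OrdinalGraph.
Local Open Scope ring_scope.
Variable G : sgraph.

Definition ordinal_adj : rel 'I_#|G| := fun i j => adj (enum_val i) (enum_val j).

Lemma ordinal_adj_sym : ssrbool.symmetric ordinal_adj.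
Proof. by move=> i j; apply: adj_sym. Qed.

Lemma ordinal_adj_irr : irreflexive ordinal_adj.
Proof. by move=> i; apply: adj_irr. Qed.

(** A copy of [G] on the indices of the variables, so that supports of monomials are vertex sets. *)
Definition ordinal_graph : sgraph := SGraph ordinal_adj_sym ordinal_adj_irr.

Lemma edge_idealE (k : fieldType) :
  @edge_ideal k G = sr_ideal (independence_complex ordinal_graph).
Proof.
have cI : simplicial_complex (independence_complex ordinal_graph).
  exact: independence_complexP.
apply/seteqP; split.
  apply: smallest_sub; first exact: sr_ideal_submodule.
  move=> _ [x [y [xy ->]]]; rewrite /vvar -mpolyXD; apply/sr_idealX.
  apply/negP => /(@independentP ordinal_graph) /(_ (enum_rank x) (enum_rank y)).
  rewrite !inE !mnmDE !mnm1E !eqxx addnS /= => /(_ isT isT).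
  by rewrite /ordinal_adj !enum_rankK xy.
move=> f If J [hJ JG]; rewrite [f]mpolyE big_seq.
apply: (submodule_sum _ hJ) => m; rewrite mcoeff_msupp => fm.
have : supp m \notin independence_complex ordinal_graph.
  by apply: contra fm => /If ->.
rewrite inE negb_forall_in => /exists_inP[i im].
rewrite negb_forall_in => /exists_inP[j jm]; rewrite negbK => ij.
(* The support of [m] contains the edge [i j] with [i != j], so the product of the two variables
   divides the monomial. *)
have -> : m = (m - (U_(i) + U_(j)) + (U_(i) + U_(j)))%MM.
  rewrite submK //; apply/mnm_lepP => l; rewrite mnmDE !mnm1E.
  have nij : i != j by apply: contraTneq ij => ->; rewrite adj_irr.
  case: (eqVneq i l) => [<-|_].
    by rewrite eq_sym (negbTE nij) addn0 lt0n; rewrite inE in im.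
  by case: eqP => // <-; rewrite lt0n; rewrite inE in jm.
rewrite mpolyXD -mul_mpolyC mulrA; apply: (submoduleM _ hJ); apply: JG.
exists (enum_val i), (enum_val j); split=> //.
by rewrite /vvar !enum_valK -mpolyXD.
Qed.

Lemma sequentially_CM_dominated (k : fieldType) (Z : {set G}) :
  Z \in independence_complex G ->
  (forall w, w \notin Z -> exists2 z, z \in Z & dominates w z) ->
  sequentially_CM_graph k G.
Proof.
move=> iZ dom; rewrite /sequentially_CM_graph edge_idealE.
pose Z' : {set ordinal_graph} := [set i | enum_val i \in Z].
have iZ' : Z' \in independence_complex ordinal_graph.
  apply/independentP => i j; rewrite !inE => iZi jZ.
  by move/independentP: iZ; apply.
have dom' w : w \notin Z' -> exists2 z, z \in Z' & dominates w z.
  rewrite inE => /dom[z zZ [wz domz]]; exists (enum_rank z).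
    by rewrite inE enum_rankK.
  split=> [|v]; rewrite /= /ordinal_adj enum_rankK //.
  by move=> /domz[/enum_val_inj|]; [left|right].
apply: (@sequentially_CM_sr_ideal k #|G| (fun A => A :\: Z')
  (fun R => R :|: @free_in ordinal_graph Z' R)).
- exact: (@independence_complexP ordinal_graph).
- by move=> A iA; split; [exact: subsetDl|exact: (@independent_sub_free ordinal_graph)].
- by move=> A B; apply: (@independent_interval ordinal_graph).
- by move=> A B _; apply: setSD.
- by move=> A B iB; apply: (@free_in_card ordinal_graph).
Qed.

End OrdinalGraph.

(** * Multi-clique coronas *)

Theorem theorem5p7 (k : fieldType) (G : sgraph) (n : G -> nat)
    (H : forall i : G, 'I_(n i) -> sgraph)
    (n_gt0 : forall i : G, 0 < n i)
    (H_nonempty : forall (i : G) (j : 'I_(n i)), 0 < #|H i j|)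
    (H_complete : forall (i : G) (j : 'I_(n i)), complete_graph (H i j)) :
  vertex_decomposable_graph (multi_corona H) /\
  sequentially_CM_graph k (multi_corona H).
Proof.
pose z (p : {i : G & 'I_(n i)}) : H (tag p) (tagged p) :=
  enum_val (Ordinal (H_nonempty (tag p) (tagged p))).
pose Z : {set multi_corona H} :=
  [set u | if u is inr b then tagged b == z (tag b) else false].
have iZ : Z \in independence_complex (multi_corona H).
  apply/independentP => -[x|[p u]] [y|[q v]]; rewrite !inE //= => /eqP-> /eqP->.
  case: (eqVneq p q) => [E|] //=; subst q.
  by rewrite tagged_asE adj_irr.
have dom w : w \notin Z -> exists2 y, y \in Z & dominates w y.
  (* A vertex [x] of [G] dominates the vertex chosen in its first clique, whose neighbours are [x]
     and members of that clique, all joined to [x]. *)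
  case: w => [x _|[p u]].
    pose p : {i : G & 'I_(n i)} := Tagged (fun i => 'I_(n i)) (Ordinal (n_gt0 x)).
    exists (inr (Tagged (fun p => H (tag p) (tagged p)) (z p))).
      by rewrite inE /=.
    split; first by rewrite /= eqxx.
    move=> [y /= /eqP<-|[q v] /= /andP[/eqP E _]]; [by left|right].
    by rewrite E.
  (* Two vertices of one clique have the same closed neighbourhood: the clique and its vertex of
     [G]. *)
  rewrite inE /= => uz.
  exists (inr (Tagged (fun p => H (tag p) (tagged p)) (z p))); first by rewrite inE /=.
  split; first by rewrite /= eqxx /= tagged_asE H_complete.
  move=> [y|[q v]] /=; first by right.
  case: (eqVneq q p) => [E|] //=; subst q.
  rewrite !tagged_asE /= => _.
  by case: (eqVneq v u) => [->|/H_complete]; [left|right].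
split; last exact: sequentially_CM_dominated iZ dom.
have := @vertex_decomposable_indep_in _ Z [set: multi_corona H] iZ.
rewrite /vertex_decomposable_graph.
suff -> : indep_in [set: multi_corona H] = independence_complex (multi_corona H).
  by apply=> w _ /dom[y yZ wy]; exists y; rewrite // inE yZ inE.
by apply/setP => F; rewrite in_indep_in subsetT andbT.
Qed.
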